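(* Let $u_i:B_1\to N\subset\mathbb R^p$ be a sequence of weakly conformal harmonic maps with uniformly bounded energy satisfying (i)-(iii) of the context. Let $$v_\infty(s,\theta)= q_\infty s + a_\infty e^s \cos\theta + b_\infty e^s \sin\theta + c_\infty e^{-s}\cos \theta + d_\infty e^{-s}\sin \theta$$ be the limit map on $\mathbb R\times S^1$ associated to (a subsequence of) $u_i$ as described in the context. Then $$q_\infty\cdot a_\infty = q_\infty \cdot b_\infty = q_\infty\cdot c_\infty =q_\infty\cdot d_\infty =0,$$ $$|q_\infty|^2= 2( a_\infty \cdot c_\infty + b_\infty \cdot d_\infty),$$ $$a_\infty\cdot d_\infty -b_\infty\cdot c_\infty=0.$$
   Context: $B_r\subset\mathbb R^2$ is the ball of radius $r$ centered at the origin, with the flat metric. $N$ is a closed Riemannian manifold isometrically embedded in $\mathbb R^p$; maps into $N$ are regarded as $\mathbb R^p$-valued. Harmonic maps are (smooth) critical points of $E(u)=\frac12\int|\nabla u|^2$. A map $u$ is weakly conformal if $|\partial_{x_1}u|=|\partial_{x_2}u|$ and $\partial_{x_1}u\cdot\partial_{x_2}u=0$ everywhere. On $B_1\setminus\{0\}$ use polar coordinates $(r,\theta)$ and cylinder coordinates $(t,\theta)$ with $t=\log r$; $u_i(t,\theta)$ means $u_i$ in these coordinates. Assumptions on the sequence $u_i:B_1\to N$ (harmonic, $\sup_iE(u_i)<\infty$): (i) $u_i$ converges locally smoothly in $\overline{B}_1\setminus\{0\}$ to a limit map $u_\infty$, which (removable singularity theorem) extends to a smooth harmonic map $B_1\to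 N$; (ii) there is a sequence $\lambda_i>0$, $\lambda_i\to0$, such that $u_i(\lambda_i y)$ converges locally smoothly on $\mathbb R^2$ to a bubble map $\omega:\mathbb R^2\to N$ (a nonconstant harmonic map of finite energy); (iii) $\omega$ is the only bubble: whenever, along a subsequence, $x_i\to 0$ and $\mu_i\to 0^+$ are such that $u_i(x_i+\mu_i y)$ converges locally smoothly on $\mathbb R^2$ minus a finite set to a nonconstant map, the quantity $\frac{\lambda_i}{\mu_i}+\frac{\mu_i}{\lambda_i}+\frac{|x_i|}{\lambda_i+\mu_i}$ is bounded along that subsequence. Neck expansion: $p_i,q_i,a_i,b_i,c_i,d_i\in\mathbb R^p$ are uniformly bounded coefficients such that, for a small fixed $\delta\in(0,1)$ and any $\alpha\in(0,1)$, for $t\in[\log(\lambda_i/\delta),\log\delta]$, $$u_i= p_i + q_i t + a_{i} e^t\cos \theta + b_{i} e^t\sin \theta + c_{i} \lambda_i e^{-t}\cos \theta + d_{i} \lambda_i e^{-t}\sin \theta + O(\eta^{1+\alpha}),\qquad \eta=e^t+\lambda_ie^{-t},$$ with $O(\eta^{1+\alpha})$ bounded by $C\eta^{1+\alpha}$, $C$ independent of $i$, and $\left||q_i|^2-2\lambda_i(a_i\cdot c_i+b_i\cdot d_i)\right|\le C\lambda_i^{1+\alpha/2}$. (The paper proves such coefficients exist.) The limit map: $v_\infty$ is the limit, in the sense of local smooth convergence on $\mathbb R\times S^1$ along a subsequence (which the paper proves exists and has the displayed form), of $$v_i(s,\theta)=\frac{1}{\sqrt{\lambda_i}}\left(u_i\left(s+\tfrac12\log\lambda_i,\theta\right)-\left(p_i+\tfrac12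 q_i\log\lambda_i\right)\right).$$ Here $a_\infty,b_\infty\in\mathbb R^p$ are given by $u_\infty(x)=p_\infty+a_\infty x_1+b_\infty x_2+o(|x|)$ as $x\to0$, and $c_\infty,d_\infty\in\mathbb R^p$ by $\tilde\omega(y)=p_\infty+c_\infty y_1+d_\infty y_2+o(|y|)$ as $y\to0$, where $\tilde\omega(y_1,y_2)=\omega\left(\frac{y_1}{|y|^2},\frac{y_2}{|y|^2}\right)$ (extended smoothly to the origin) and $p_\infty=u_\infty(0)=\tilde\omega(0)$; $q_\infty\in\mathbb R^p$ is the remaining coefficient of $v_\infty$. *)

(* Defs.v *)
From HB Require Import structures.
From mathcomp Require Import all_boot all_order all_algebra.
From mathcomp Require Import all_classical all_reals all_analysis.

Set Implicit Arguments.
Unset Strict Implicit.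
Unset Printing Implicit Defensive.

Import Order.TTheory GRing.Theory Num.Theory.
Import numFieldNormedType.Exports.

Local Open Scope classical_set_scope.
Local Open Scope ring_scope.

(* R^p is ['rV[R]_p], the plane is [R * R]. The norms [`| _ |] which the
   library puts on these types are sup norms, so the Euclidean structure is
   introduced here. *)
Section Euclidean.
Variable R : realType.

Definition dotv (p : nat) (v w : 'rV[R]_p) : R := \sum_(j < p) v 0 j * w 0 j.

Definition enorm (p : nat) (v : 'rV[R]_p) : R := Num.sqrt (dotv v v).

Definition enorm2 (x : R * R) : R := Num.sqrt (x.1 ^+ 2 + x.2 ^+ 2).

Definition disk (r : R) : set (R * R) := [set x | enorm2 x < r].

Definition cdisk (r : R) : set (R * R) := [set x | enorm2 x <= r].

Definition partial1 (p : nat) (u : R * R -> 'rV[R]_p) : R * R -> 'rV[R]_p :=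
  'D_((1, 0) : R * R) u.

Definition partial2 (p : nat) (u : R * R -> 'rV[R]_p) : R * R -> 'rV[R]_p :=
  'D_((0, 1) : R * R) u.

End Euclidean.

Section Smoothness.
Variables (R : realType) (V W : normedModType R).

Definition iter_dderive (vs : seq V) (f : V -> W) : V -> W :=
  foldr (fun v g => 'D_v g) f vs.

(* For [D] open and [V], [W] finite-dimensional this is C^infinity on [D]:
   all iterated directional derivatives exist and are Frechet differentiable
   (hence continuous) at every point of [D]. *)
Definition smooth_on (D : set V) (f : V -> W) : Prop :=
  forall (vs : seq V) (x : V), D x -> differentiable (iter_dderive vs f) x.

(* Local smooth convergence on [A]: all derivatives converge uniformly on
   compact subsets of [A]. When [A] is not open, derivatives are only taken
   at points of an open set [D] such that [A `&` D] is dense in [A]; this is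
   convergence up to the part of the boundary of [D] that lies in [A]. For
   [A] open, take [D := setT]. *)
Definition loc_smooth_cvg (D A : set V) (f : nat -> V -> W) (g : V -> W) :
    Prop :=
  forall K : set V, compact K -> K `<=` A ->
  forall vs : seq V,
    {uniform K `&` D, (fun i => iter_dderive vs (f i)) @ \oo --> iter_dderive vs g}.

End Smoothness.

Section Manifold.
Variables (R : realType) (p : nat).

(* In the coordinates [Phi] on the neighbourhood [U] of [y], the set [N] is
   the slice R^n x {0} of R^p. *)
Definition slice_chart (N : set 'rV[R]_p) (n : nat) (y : 'rV[R]_p) : Prop :=
  exists (U V : set 'rV[R]_p) (Phi Psi : 'rV[R]_p -> 'rV[R]_p),
    [/\ open U, U y & open V] /\
    [/\ smooth_on U Phi, smooth_on V Psi,
        forall z, U z -> V (Phi z) /\ Psi (Phi z) = z &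
        forall w, V w -> U (Psi w) /\ Phi (Psi w) = w] /\
    (forall z, U z -> (N z <-> forall j : 'I_p, (n <= j)%N -> Phi z 0 j = 0)).

(* A compact embedded submanifold without boundary of R^p; its Riemannian
   metric is the one induced by R^p. *)
Definition closed_submanifold (N : set 'rV[R]_p) : Prop :=
  compact N /\
  exists n : nat, (n <= p)%N /\ forall y, N y -> slice_chart N n y.

End Manifold.

Section HarmonicMaps.
Variables (R : realType) (p : nat).
Implicit Types (D : set (R * R)) (u : R * R -> 'rV[R]_p).

Definition energy D u : \bar R :=
  ((2^-1)%:E *
   \int[(@lebesgue_measure R \x @lebesgue_measure R)%E]_(x in D)
     (enorm (partial1 u x) ^+ 2 + enorm (partial2 u x) ^+ 2)%:E)%E.

(* [U s], for [`|s| < e], is a smooth variation of [u] through maps from [D]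
   into [N], fixed outside the compact subset [K] of [D]. *)
Definition admissible_variation (N : set 'rV[R]_p) D u (K : set (R * R))
    (e : R) (U : R -> R * R -> 'rV[R]_p) : Prop :=
  [/\ compact K, K `<=` D & 0 < e] /\
  [/\ smooth_on [set z : R * (R * R) | `|z.1| < e /\ D z.2]
        (fun z : R * (R * R) => U z.1 z.2),
      forall s x, `|s| < e -> D x -> N (U s x),
      forall x, D x -> U 0 x = u x &
      forall s x, `|s| < e -> D x -> ~ K x -> U s x = u x].

(* Smooth critical points of the energy among maps from [D] to [N]. The
   energy of a variation is measured on [K], outside of which it is constant,
   so that the definition also makes sense if [u] has infinite energy. *)
Definition harmonic_map (N : set 'rV[R]_p) D u : Prop :=
  [/\ smooth_on D u,
      forall x, D x -> N (u x) &
      forall K e U, admissible_variation N D u K e U ->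
        is_derive (0 : R) (1 : R) (fun s => fine (energy K (U s))) 0].

Definition weakly_conformal D u : Prop :=
  forall x, D x ->
    enorm (partial1 u x) = enorm (partial2 u x) /\
    dotv (partial1 u x) (partial2 u x) = 0.

Definition nonconstant_on D u : Prop :=
  exists x y, [/\ D x, D y & u x <> u y].

Definition bubble_map (N : set 'rV[R]_p) (omega : R * R -> 'rV[R]_p) : Prop :=
  [/\ harmonic_map N setT omega, nonconstant_on setT omega &
      (energy setT omega < +oo)%E].

(* [u i] is only meaningful on the unit disk. In the rescalings below every
   compact set is eventually mapped into that disk, so other values do not
   matter. *)
Definition only_bubble (u : nat -> R * R -> 'rV[R]_p) (lam : nat -> R) : Prop :=
  forall (phi : nat -> nat) (x : nat -> R * R) (mu : nat -> R)
         (S : set (R * R)) (w : R * R -> 'rV[R]_p),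
    {homo phi : m n / (m < n)%N} ->
    x @ \oo --> (0 : R * R) ->
    (forall k, 0 < mu k) -> mu @ \oo --> (0 : R) ->
    finite_set S ->
    loc_smooth_cvg setT (~` S)
      (fun k (y : R * R) => u (phi k) (x k + mu k *: y)) w ->
    nonconstant_on (~` S) w ->
    exists C : R, forall k,
      lam (phi k) / mu k + mu k / lam (phi k)
        + enorm2 (x k) / (lam (phi k) + mu k) <= C.

(* Cylinder coordinates (t, theta), t = log r; functions on R x S^1 are
   handled as functions on the plane. *)
Definition cyl u (z : R * R) : 'rV[R]_p :=
  u (expR z.1 * cos z.2, expR z.1 * sin z.2).

Definition neck_form (p0 q a b c d : 'rV[R]_p) (l t theta : R) : 'rV[R]_p :=
  p0 + t *: q
  + (expR t * cos theta) *: a + (expR t * sin theta) *: b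
  + (l * expR (- t) * cos theta) *: c + (l * expR (- t) * sin theta) *: d.

Definition neck_expansion (u : nat -> R * R -> 'rV[R]_p) (lam : nat -> R)
    (delta : R) (p_ q_ a_ b_ c_ d_ : nat -> 'rV[R]_p) : Prop :=
  (exists M : R, forall i,
    [/\ enorm (p_ i) <= M, enorm (q_ i) <= M & enorm (a_ i) <= M] /\
    [/\ enorm (b_ i) <= M, enorm (c_ i) <= M & enorm (d_ i) <= M]) /\
  forall alpha : R, 0 < alpha < 1 ->
  exists C : R, forall i,
    (forall t theta, ln (lam i / delta) <= t <= ln delta ->
      enorm (cyl (u i) (t, theta)
             - neck_form (p_ i) (q_ i) (a_ i) (b_ i) (c_ i) (d_ i)
                 (lam i) t theta)
      <= C * (expR t + lam i * expR (- t)) `^ (1 + alpha)) /\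
    `| enorm (q_ i) ^+ 2
       - 2 * lam i * (dotv (a_ i) (c_ i) + dotv (b_ i) (d_ i)) |
      <= C * lam i `^ (1 + alpha / 2).

Definition neck_rescaling u (l : R) (p0 q : 'rV[R]_p) (z : R * R) :
    'rV[R]_p :=
  (Num.sqrt l)^-1 *:
    (cyl u (z.1 + 2^-1 * ln l, z.2) - (p0 + (2^-1 * ln l) *: q)).

Definition neck_limit (q a b c d : 'rV[R]_p) (z : R * R) : 'rV[R]_p :=
  z.1 *: q
  + (expR z.1 * cos z.2) *: a + (expR z.1 * sin z.2) *: b
  + (expR (- z.1) * cos z.2) *: c + (expR (- z.1) * sin z.2) *: d.

Definition inversion (y : R * R) : R * R :=
  (y.1 / enorm2 y ^+ 2, y.2 / enorm2 y ^+ 2).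

Definition first_order_expansion u (p0 a b : 'rV[R]_p) : Prop :=
  (fun x : R * R => u x - (p0 + x.1 *: a + x.2 *: b))
    =o_ (0 : R * R) (fun x : R * R => x).

End HarmonicMaps.

(* Main.v *)
Require Import Defs.
From mathcomp Require Import all_boot all_order all_algebra.
From mathcomp Require Import all_classical all_reals all_analysis.
From mathcomp Require Import ring lra.
Import Order.TTheory GRing.Theory Num.Theory.
Import numFieldNormedType.Exports.

(** The relations say exactly that the limit map is weakly conformal, and weak
conformality survives every operation that leads from [u_i] to that map.

Passing to cylinder coordinates and translating by [ln lam / 2] is the
precomposition with [z |-> exp (z + m)], a holomorphic change of variables; such
a map rotates and dilates the frame of partial derivatives, hence preserves weak
conformality ([weakly_conformal_comp]). Subtracting a constant and dividing by
[sqrt lam] preserve it too. Since [lam] tends to 0, each point of the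
cylinder is eventually sent into the unit disk, so at that point the rescaled
maps are weakly conformal from some index on
([weakly_conformal_neck_rescaling]). Pointwise convergence of the first
derivatives then makes the limit weakly conformal on the whole cylinder
([weakly_conformal_lim]).

It remains to read off the coefficients. On the line [theta = 0], with
[x = exp s], the two derivatives of the limit are [q + x a - c / x] and
[x b + d / x]. Their having equal lengths and being orthogonal are two identities
between Laurent polynomials in [x]. The coefficients of [x], [1] and [1 / x]
are, up to factors, [q.a], [|q|^2 - 2 (a.c + b.d)] and [q.c] in the first one,
and [q.b], [a.d - b.c] and [q.d] in the second one; all of them vanish
([weakly_conformal_neck_limit]). *)

Set Implicit Arguments.
Unset Strict Implicit.

Local Open Scope classical_set_scope.
Local Open Scope ring_scope.

(** * The Euclidean inner product *)

Section Dotv.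
Context {R : realType} {p : nat}.
Implicit Types v w x : 'rV[R]_p.

Lemma dotvC v w : dotv v w = dotv w v.
Proof. by apply: eq_bigr => j _; rewrite mulrC. Qed.

Lemma dotvDl v w x : dotv (v + w) x = dotv v x + dotv w x.
Proof. by rewrite -big_split; apply: eq_bigr => j _; rewrite mxE mulrDl. Qed.

Lemma dotvZl k v w : dotv (k *: v) w = k * dotv v w.
Proof. by rewrite mulr_sumr; apply: eq_bigr => j _; rewrite mxE mulrA. Qed.

Lemma dotvDr v w x : dotv v (w + x) = dotv v w + dotv v x.
Proof. by rewrite dotvC dotvDl !(dotvC v). Qed.

Lemma dotvZr k v w : dotv v (k *: w) = k * dotv v w.
Proof. by rewrite dotvC dotvZl dotvC. Qed.

Lemma dotvv_ge0 v : 0 <= dotv v v.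
Proof. by apply: sumr_ge0 => j _; exact: sqr_ge0. Qed.

Lemma sqr_enorm v : enorm v ^+ 2 = dotv v v.
Proof. by rewrite sqr_sqrtr// dotvv_ge0. Qed.

Lemma eq_enorm v w : enorm v = enorm w <-> dotv v v = dotv w w.
Proof.
by rewrite -!sqr_enorm; split=> [->//|] /eqP; rewrite eqrXn2 ?sqrtr_ge0// => /eqP.
Qed.

Lemma cvg_dotv (f g : nat -> 'rV[R]_p) v w :
  f @ \oo --> v -> g @ \oo --> w ->
  (fun k => dotv (f k) (g k)) @ \oo --> dotv v w.
Proof.
move=> fv gw; apply: cvg_big => [|j _]; first exact: add_continuous.
have coordE (y : 'rV[R]_p) := @coord_continuous R 1 p 0 j y.
apply: cvgM; first exact: (cvg_comp _ (fun y : 'rV[R]_p => y 0 j) fv (coordE v)).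
exact: (cvg_comp _ (fun y : 'rV[R]_p => y 0 j) gw (coordE w)).
Qed.

End Dotv.

(** * Differentials of elementary functions of two variables *)

Section Differentials.
Context {R : realType}.
Implicit Types z : R * R.

Lemma is_diff_fst z : is_diff z fst fst.
Proof.
have c : continuous (fst : R * R -> R) by move=> x; exact: cvg_fst.
by apply: DiffDef; [exact: linear_differentiable|exact: diff_lin].
Qed.

Lemma is_diff_snd z : is_diff z snd snd.
Proof.
have c : continuous (snd : R * R -> R) by move=> x; exact: cvg_snd.
by apply: DiffDef; [exact: linear_differentiable|exact: diff_lin].
Qed.

Lemma is_diff_real (f : R -> R) (x df : R) :
  is_derive x 1 f df -> is_diff x f ( *%R df).
Proof.
move=> fx; have dfx : differentiable f x by apply/derivable1_diffP.
apply: DiffDef => //.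
by rewrite diff1E// derive1E derive_val; apply/funext => h /=; rewrite mulrC.
Qed.

Lemma is_diff_expR_comp z (g dg : R * R -> R) : is_diff z g dg ->
  is_diff z (fun x => expR (g x)) (fun h => expR (g z) * dg h).
Proof.
move=> gz; have ez := is_diff_real (is_derive_expR (g z)).
exact: (@is_diff_comp _ _ _ _ _ _ _ _ _ gz ez).
Qed.

Lemma is_diff_expR_cos z (g dg : R * R -> R) : is_diff z g dg ->
  is_diff z (fun x => expR (g x) * cos x.2)
    (fun h => expR (g z) * (cos z.2 * dg h - sin z.2 * h.2)).
Proof.
move=> /is_diff_expR_comp ez; have cz := is_diff_real (is_derive_cos z.2).
have csz := @is_diff_comp _ _ _ _ _ _ _ _ _ (is_diff_snd z) cz.
apply: is_diff_eq (is_diffM ez csz) _.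
by apply/funext => h; rewrite !fctE /= /GRing.scale /=; ring.
Qed.

Lemma is_diff_expR_sin z (g dg : R * R -> R) : is_diff z g dg ->
  is_diff z (fun x => expR (g x) * sin x.2)
    (fun h => expR (g z) * (sin z.2 * dg h + cos z.2 * h.2)).
Proof.
move=> /is_diff_expR_comp ez; have sz := is_diff_real (is_derive_sin z.2).
have snz := @is_diff_comp _ _ _ _ _ _ _ _ _ (is_diff_snd z) sz.
apply: is_diff_eq (is_diffM ez snz) _.
by apply/funext => h; rewrite !fctE /= /GRing.scale /=; ring.
Qed.

Lemma is_diff_scale_comp p z (g dg : R * R -> R) (v : 'rV[R]_p) :
  is_diff z g dg -> is_diff z (fun x => g x *: v) (fun h => dg h *: v).
Proof.
by move=> gz; exact: (@is_diff_comp _ _ _ _ _ _ _ _ _ gz (is_diff_scalel (g z) v)).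
Qed.

(** This map is the complex exponential [z |-> exp (z + m)], so its differential
is the multiplication by the complex number [exp (z + m)]. *)
Lemma is_diff_polar z (m : R) :
  is_diff z
    (fun x : R * R => (expR (x.1 + m) * cos x.2, expR (x.1 + m) * sin x.2))
    (fun h => let r := expR (z.1 + m) in
       (r * cos z.2 * h.1 - r * sin z.2 * h.2,
        r * sin z.2 * h.1 + r * cos z.2 * h.2)).
Proof.
have d1 : is_diff z (fun x : R * R => x.1 + m) (fun h => h.1).
  apply: (is_diff_eq (is_diffD (is_diff_fst z) (is_diff_cst m z))).
  by rewrite addr0.
apply: is_diff_eq (is_diff_pair (is_diff_expR_cos d1) (is_diff_expR_sin d1)) _.
by apply/funext => h /=; congr (_, _); ring.
Qed.

Lemma is_diff_neck_limit p (q a b c d : 'rV[R]_p) z :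
  is_diff z (neck_limit q a b c d)
    (fun h => h.1 *: q
       + (expR z.1 * (cos z.2 * h.1 - sin z.2 * h.2)) *: a
       + (expR z.1 * (sin z.2 * h.1 + cos z.2 * h.2)) *: b
       + (expR (- z.1) * (cos z.2 * (- h.1) - sin z.2 * h.2)) *: c
       + (expR (- z.1) * (sin z.2 * (- h.1) + cos z.2 * h.2)) *: d).
Proof.
have [dz dNz] := (is_diff_fst z, is_diffN (is_diff_fst z)).
exact: (is_diffD (is_diffD (is_diffD (is_diffD
  (is_diff_scale_comp q dz)
  (is_diff_scale_comp a (is_diff_expR_cos dz)))
  (is_diff_scale_comp b (is_diff_expR_sin dz)))
  (is_diff_scale_comp c (is_diff_expR_cos dNz)))
  (is_diff_scale_comp d (is_diff_expR_sin dNz))).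
Qed.

End Differentials.

(** * Stability of weak conformality *)

Lemma eq_lim_near (R : realType) (s t : nat -> R) (x y : R) :
  s @ \oo --> x -> t @ \oo --> y -> (\forall k \near \oo, s k = t k) -> x = y.
Proof.
move=> sx ty st; apply: (cvg_unique (@norm_hausdorff _ R^o) sx).
apply: cvg_trans ty; apply: near_eq_cvg.
by apply: filterS st => k ->.
Qed.

Section Conformal.
Context {R : realType} {p : nat}.
Implicit Types (D E : set (R * R)) (u : R * R -> 'rV[R]_p).

(** The hypothesis on [f] is the Cauchy-Riemann system: the differential of [f] is
the multiplication by the complex number [al + i be]. By the chain rule the
partial derivatives of [u \o f] are then the vectors [al u_1 + be u_2] and
[- be u_1 + al u_2], again orthogonal and of equal length. *)
Lemma weakly_conformal_comp D E u (f : R * R -> R * R) (al be : R * R -> R) :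
  (forall z, D z -> E (f z)) ->
  (forall z, D z -> is_diff z f
     (fun h => (al z * h.1 - be z * h.2, be z * h.1 + al z * h.2))) ->
  (forall x, E x -> differentiable u x) ->
  weakly_conformal E u -> weakly_conformal D (u \o f).
Proof.
move=> fDE df du cu z Dz; have Efz := fDE _ Dz; have dfz := df _ Dz.
have duz := du _ Efz.
have D12 h1 h2 : 'd u (f z) (h1, h2) =
    h1 *: partial1 u (f z) + h2 *: partial2 u (f z).
  rewrite /partial1 /partial2 !(deriveE _ duz) -!linearZ -linearD.
  congr ('d u (f z) _); apply/pair_eqP.
  by rewrite /= /GRing.scale /= !mulr0 !mulr1 addr0 add0r !eqxx.
have Dcomp h : 'D_h (u \o f) z =
    (al z * h.1 - be z * h.2) *: partial1 u (f z)
    + (be z * h.1 + al z * h.2) *: partial2 u (f z).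
  rewrite deriveE; last exact: differentiable_comp.
  rewrite (diff_comp (@ex_diff _ _ _ _ _ _ _ dfz) duz) /= -D12.
  congr ('d u (f z) _).
  by have /(congr1 (@^~ h)) := @diff_val _ _ _ _ _ _ _ dfz.
have [/eq_enorm uu uo] := cu _ Efz.
rewrite eq_enorm /partial1 /partial2 !Dcomp /=.
rewrite !mulr0 !mulr1 subr0 addr0 sub0r add0r.
move: (partial1 u (f z)) (partial2 u (f z)) uu uo => v w vvw vw0.
rewrite !dotvDl !dotvDr !dotvZl !dotvZr.
rewrite (dotvC w v) vw0 vvw; split; ring.
Qed.

Lemma weakly_conformal_affine D u k (c : 'rV[R]_p) :
  (forall x, D x -> differentiable u x) ->
  weakly_conformal D u -> weakly_conformal D (k *: (u - cst c)).
Proof.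
move=> du cu z Dz.
have dz v : 'D_v (k *: (u - cst c)) z = k *: 'D_v u z.
  have d v' : derivable u z v' by apply: diff_derivable; exact: du.
  have dc v' : derivable (cst c : R * R -> 'rV[R]_p) z v' by exact: derivable_cst.
  rewrite (deriveZ _ (derivableB (d v) (dc v))) (deriveB (d v) (dc v)).
  by rewrite derive_cst subr0.
have [/eq_enorm uu uo] := cu _ Dz.
rewrite eq_enorm /partial1 /partial2 !dz -/(partial1 u z) -/(partial2 u z).
move: (partial1 u z) (partial2 u z) uu uo => v w vvw vw0.
by rewrite !dotvZl !dotvZr vvw vw0 !mulr0.
Qed.

(** Weak conformality at a point is a closed condition on the first derivatives
at that point, so it passes to the limit as soon as it holds there from some
index on; the index may depend on the point. *)
Lemma weakly_conformal_lim (f : nat -> R * R -> 'rV[R]_p) g :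
  loc_smooth_cvg setT setT f g ->
  (forall z, \forall k \near \oo, weakly_conformal [set z] (f k)) ->
  weakly_conformal setT g.
Proof.
move=> fg fc z _.
have cvgD v : (fun k => 'D_v (f k) z) @ \oo --> 'D_v g z.
  have := fg _ (@compact_set1 _ z) (subsetT _) [:: v].
  by rewrite setIT uniform_set1.
have c1 := cvgD (1, 0); have c2 := cvgD (0, 1).
rewrite eq_enorm; split.
  apply: (eq_lim_near (cvg_dotv c1 c1) (cvg_dotv c2 c2)).
  near=> k; apply/eq_enorm.
  by have /(_ z erefl)[] : weakly_conformal [set z] (f k) by near: k.
apply: (eq_lim_near (cvg_dotv c1 c2) (cvg_cst (0 : R))).
near=> k.
by have /(_ z erefl)[] : weakly_conformal [set z] (f k) by near: k.
Unshelve. all: by end_near. Qed.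

(** The hypothesis on [z] says that the point at which [neck_rescaling] evaluates
[u] lies in the open unit disk. *)
Lemma weakly_conformal_neck_rescaling u (l : R) (p0 q : 'rV[R]_p) (z : R * R) :
  (forall x, disk 1 x -> differentiable u x) -> weakly_conformal (disk 1) u ->
  z.1 + 2^-1 * ln l < 0 ->
  weakly_conformal [set z] (neck_rescaling u l p0 q).
Proof.
move=> du cu zl.
set m := 2^-1 * ln l in zl.
pose f (x : R * R) := (expR (x.1 + m) * cos x.2, expR (x.1 + m) * sin x.2).
have fz1 : disk 1 (f z).
  rewrite /disk /enorm2 /= !exprMn -mulrDr cos2Dsin2 mulr1 sqrtr_sqr.
  rewrite ger0_norm ?expR_ge0//.
  by rewrite -expR0 ltr_expR.
have df : is_diff z f _ := is_diff_polar z m.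
apply: (@weakly_conformal_affine _ (u \o f)) => [x -> |].
  exact: differentiable_comp (du _ fz1).
apply: (@weakly_conformal_comp _ _ _ _ (fun=> expR (z.1 + m) * cos z.2)
  (fun=> expR (z.1 + m) * sin z.2) _ _ du cu) => x ->//.
Qed.

End Conformal.

(** * The coefficients of a weakly conformal limit *)

Section Coefficients.
Context {R : realType} {p : nat}.

(** After multiplication by [x ^+ 2] this is a polynomial of degree at most 4, so
five zeros force all its coefficients to vanish; the zeros 1, ..., 5 are used. *)
Lemma laurent_eq0 (k2 k1 k0 l1 l2 : R) :
  (forall x, 0 < x ->
     k2 * x ^+ 2 + k1 * x + k0 + l1 * x^-1 + l2 * x^-1 ^+ 2 = 0) ->
  [/\ k2 = 0, k1 = 0, k0 = 0, l1 = 0 & l2 = 0].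
Proof.
move=> k.
have pos n : 0 < n.+1%:R :> R := ltr0Sn R n.
move: (k 1%:R (pos 0)) (k 2%:R (pos 1)) (k 3%:R (pos 2)).
move: (k 4%:R (pos 3)) (k 5%:R (pos 4)) => h4 h5 h1 h2 h3.
by split; lra.
Qed.

(** Restricting to [theta = 0] suffices, because on that line all six relations
already occur as coefficients of the two Laurent polynomials in [x = expR s]. *)
Lemma weakly_conformal_neck_limit (q a b c d : 'rV[R]_p) :
  weakly_conformal setT (neck_limit q a b c d) ->
  [/\ dotv q a = 0, dotv q b = 0, dotv q c = 0 & dotv q d = 0] /\
  dotv q q = 2 * (dotv a c + dotv b d) /\ dotv a d - dotv b c = 0.
Proof.
move=> cf.
have D x : 0 < x ->
    partial1 (neck_limit q a b c d) (ln x, 0) = q + x *: a + (- x^-1) *: c /\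
    partial2 (neck_limit q a b c d) (ln x, 0) = x *: b + x^-1 *: d.
  move=> x0; have df := is_diff_neck_limit q a b c d (ln x, 0).
  have diff_nl := @ex_diff _ _ _ _ _ _ _ df.
  rewrite /partial1 /partial2 !(deriveE _ diff_nl) (@diff_val _ _ _ _ _ _ _ df) /=.
  rewrite expRN lnK // cos0 sin0 !(mulr0, mul0r, mulr1, mul1r,
    scale0r, scale1r, subr0, addr0, add0r, oppr0, mulrN1).
  by [].
have qab : [/\ dotv a b = 0, dotv q b = 0, dotv a d - dotv b c = 0,
    dotv q d = 0 & - dotv c d = 0].
  apply: laurent_eq0 => x x0; have [D1 D2] := D x x0.
  have [_] := cf (ln x, 0) I; rewrite D1 D2.
  rewrite !dotvDl !dotvDr !dotvZl !dotvZr (dotvC c b) => <-.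
  by field; rewrite gt_eqF.
have qac : [/\ dotv a a - dotv b b = 0, 2 * dotv q a = 0,
    dotv q q - 2 * dotv a c - 2 * dotv b d = 0, - (2 * dotv q c) = 0
    & dotv c c - dotv d d = 0].
  apply: laurent_eq0 => x x0; have [D1 D2] := D x x0.
  have [/eq_enorm/eqP + _] := cf (ln x, 0) I; rewrite D1 D2 -subr_eq0 => /eqP.
  rewrite !dotvDl !dotvDr !dotvZl !dotvZr.
  rewrite (dotvC a q) (dotvC c q) (dotvC c a) (dotvC d b) => <-.
  by field; rewrite gt_eqF.
by move: qab qac => [_ ? ? ? _] [_ ? ? ? _]; split; [split|split]; lra.
Qed.

End Coefficients.

(** * The limit of the rescaled necks *)

Lemma leq_increasing (phi : nat -> nat) :
  {homo phi : m n / (m < n)%N} -> forall k, (k <= phi k)%N.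
Proof.
by move=> h; elim=> // k ih; exact: leq_ltn_trans ih (h _ _ (ltnSn k)).
Qed.

Unset Implicit Arguments.
Set Strict Implicit.

Theorem theorem1p4 (R : realType) (p : nat)
  (N : set 'rV[R]_p) (hN : closed_submanifold N)
  (u : nat -> R * R -> 'rV[R]_p)
  (hharm : forall i, harmonic_map N (disk 1) (u i))
  (hconf : forall i, weakly_conformal (disk 1) (u i))
  (henergy : exists E0 : R, forall i, (energy (disk 1) (u i) <= E0%:E)%E)
  (uinf : R * R -> 'rV[R]_p)
  (huinf : harmonic_map N (disk 1) uinf)
  (hcvg : loc_smooth_cvg (disk 1) (cdisk 1 `\ (0 : R * R)) u uinf)
  (lam : nat -> R) (lam_gt0 : forall i, 0 < lam i)
  (lam_cvg0 : lam @ \oo --> (0 : R))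
  (omega : R * R -> 'rV[R]_p) (homega : bubble_map N omega)
  (hbubble : loc_smooth_cvg setT setT
     (fun i (y : R * R) => u i (lam i *: y)) omega)
  (honly : only_bubble u lam)
  (delta : R) (hdelta : 0 < delta < 1)
  (p_ q_ a_ b_ c_ d_ : nat -> 'rV[R]_p)
  (hneck : neck_expansion u lam delta p_ q_ a_ b_ c_ d_)
  (omegat : R * R -> 'rV[R]_p) (homegat_smooth : smooth_on setT omegat)
  (homegat : forall y : R * R, y <> 0 -> omegat y = omega (inversion y))
  (pinf qinf ainf binf cinf dinf : 'rV[R]_p)
  (hpu : pinf = uinf 0) (hpomega : pinf = omegat 0)
  (hab : first_order_expansion uinf pinf ainf binf)
  (hcd : first_order_expansion omegat pinf cinf dinf)
  (phi : nat -> nat) (hphi : {homo phi : m n / (m < n)%N})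
  (hlim : loc_smooth_cvg setT setT
     (fun k => neck_rescaling (u (phi k)) (lam (phi k))
                 (p_ (phi k)) (q_ (phi k)))
     (neck_limit qinf ainf binf cinf dinf)) :
  [/\ dotv qinf ainf = 0, dotv qinf binf = 0,
      dotv qinf cinf = 0 & dotv qinf dinf = 0] /\
  enorm qinf ^+ 2 = 2 * (dotv ainf cinf + dotv binf dinf) /\
  dotv ainf dinf - dotv binf cinf = 0.
Proof.
have conf_lim : weakly_conformal setT (neck_limit qinf ainf binf cinf dinf).
  apply: (weakly_conformal_lim hlim) => z.
  have [K _ lamK] : \forall n \near \oo, lam n < expR (- 2 * z.1).
    have lam_lt := (cvgrPdist_lt _ _).1 lam_cvg0 _ (expR_gt0 (- 2 * z.1)).
    near=> n; rewrite -[lam n]gtr0_norm// -normrN -sub0r.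
    by near: n; exact: lam_lt.
  exists K; first by [].
  move=> k Kk /=.
  have du x : disk 1 x -> differentiable (u (phi k)) x.
    by move=> x1; have [us _ _] := hharm (phi k); exact: (us [::] x x1).
  have lamk : lam (phi k) < expR (- 2 * z.1).
    by apply: lamK; exact: leq_trans Kk (leq_increasing hphi k).
  have zlt0 : z.1 + 2^-1 * ln (lam (phi k)) < 0.
    by move: lamk; rewrite -ltr_ln ?posrE ?expR_gt0// expRK; lra.
  exact: (weakly_conformal_neck_rescaling _ _ du (hconf (phi k)) zlt0).
by rewrite sqr_enorm; exact: weakly_conformal_neck_limit conf_lim.
Unshelve. all: by end_near. Qed.
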